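(* There is an absolute constant $C>1$ such that for every finite set $U$ of size $N$, every $\epsilon>0$ and every $\Delta\ge 0$, there exists a $(\Delta,\epsilon,\mathcal P(U),L)$-UCS over $U$ with $L(P)\le C^{\,H(P)/\epsilon+\Delta\log^* N}$ for all $P\in\mathcal P(U)$.
   Context: $\mathcal P(U)$ denotes the set of all probability distributions on the finite set $U$; $\{0,1\}^*$ is the set of finite binary strings and $|x|$ the length of $x$. For $P,Q\in\mathcal P(U)$ and $\Delta\ge0$, $P$ and $Q$ are $\Delta$-close if for all $m\in U$, $\log_2(P(m)/Q(m))\le\Delta$ and $\log_2(Q(m)/P(m))\le\Delta$. $H(P)=\sum_{m}P(m)\log_2(1/P(m))$. $\log^{(i)}$ denotes the $i$-fold iterated base-2 logarithm ($\log^{(0)}N=N$), and $\log^* N$ is the least integer $i$ with $\log^{(i)}N\le 1$. For $\Delta\ge0$, $\epsilon\in[0,1]$, a class $\mathcal F\subseteq\mathcal P(U)$ and $L:\mathcal F\to\mathbb R^+$, a $(\Delta,\epsilon,\mathcal F,L)$-UCS over $U$ is a pair $E:\mathcal F\times U\to\{0,1\}^*\cup\{\bot\}$, $D:\mathcal F\times(\{0,1\}^*\cup\{\bot\})\to U\cup\{\bot\}$ such that: (1) for all $\Delta$-close $P,Q\in\mathcal F$ and all $m\in U$, if $E(P,m)\ne\bot$ then $D(Q,E(P,m))=m$, and $D(Q,\bot)=\bot$; (2) for every $P\in\mathcal F$, $\Pr_{m\sim P}[E(P,m)=\bot]\le\epsilon$; (3) for every $P\in\mathcal F$, $\mathbb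 E_{m\sim P}[|E(P,m)|]\le L(P)$ (with $|\bot|$ counted as a constant). *)

(* Defs.v *)
From Stdlib Require Import Reals List.
Open Scope R_scope.

Definition log2 (x : R) : R := ln x / ln 2.

Definition finite_enum {T : Type} (enum : list T) : Prop :=
  NoDup enum /\ forall x : T, In x enum.

Definition sumU {T : Type} (enum : list T) (f : T -> R) : R :=
  fold_right (fun m acc => f m + acc) 0 enum.

Definition is_dist {T : Type} (enum : list T) (P : T -> R) : Prop :=
  (forall m, 0 <= P m) /\ sumU enum P = 1.

(* Delta-closeness: log2(P m/Q m) <= Delta and log2(Q m/P m) <= Delta,
   written multiplicatively (handles zero probabilities). *)
Definition close (Delta : R) {T : Type} (P Q : T -> R) : Prop :=
  forall m, P m <= Rpower 2 Delta * Q m /\ Q m <= Rpower 2 Delta * P m.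

(* Shannon entropy; terms with P m = 0 contribute 0 * _ = 0. *)
Definition entropy {T : Type} (enum : list T) (P : T -> R) : R :=
  sumU enum (fun m => P m * log2 (/ P m)).

Fixpoint logstar_aux (fuel : nat) (x : R) : nat :=
  match fuel with
  | O => O
  | S f => if Rle_dec x 1 then O else S (logstar_aux f (log2 x))
  end.
(* least i with log^(i) N <= 1; fuel N+1 is always sufficient *)
Definition logstar (N : nat) : nat := logstar_aux (S N) (INR N).

Definition bot_len : R := 1.
Definition enc_len (c : option (list bool)) : R :=
  match c with
  | None => bot_len
  | Some s => INR (length s)
  end.

Definition is_UCS {T : Type} (enum : list T) (Delta eps : R) (L : (T -> R) -> R)
  (E : (T -> R) -> T -> option (list bool))
  (D : (T -> R) -> option (list bool) -> option T) : Prop :=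
  (forall P Q, is_dist enum P -> is_dist enum Q -> close Delta P Q ->
     forall m s, E P m = Some s -> D Q (Some s) = Some m)
  /\ (forall Q, is_dist enum Q -> D Q None = None)
  /\ (forall P, is_dist enum P ->
        sumU enum (fun m => match E P m with None => P m | Some _ => 0 end) <= eps)
  /\ (forall P, is_dist enum P ->
        sumU enum (fun m => P m * enc_len (E P m)) <= L P).

(* Main.v *)
(** The encoder uses only the messages [m] with [P m >= 2 ^ - t], where [t] is about
    [H(P) / eps], so by Markov's inequality it fails with probability at most [eps].  It sends [t]
    in unary, followed by a colour of [(P, m)] chosen such that distinct messages get distinct
    colours whenever their distributions are close to a common [Q].

    Such a colouring comes from Linial's colour reduction.  Let the level of [m] be the least [j]
    with [P m >= 2 ^ - (t + 2 j Delta)]; passing to a [2 Delta]-close distribution moves each level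
    by at most one.  Starting from the colour [m], each round replaces the colour, read as a
    polynomial over [GF(2^k)], by its value at a point separating it from the colours of all
    neighbours.  The colour after [i] rounds depends only on the levels truncated at [i + 1], and
    at most [a = 2 ^ (t + O(Delta log* N))] messages have level at most [log* N + 1], so a vertex
    sees at most [3 ^ a * a] neighbouring colours.  Hence after [log* N] rounds [O(a)] bits remain.

    When [H(P) / eps + Delta log* N < 1 / 4] the bound leaves no room for constants; then the only
    message encoded is the one of probability at least [2 ^ - (1 / 4)], by the empty string. *)
Require Import Defs.
From Stdlib Require Import Reals List Arith ZArith Lia Lra Classical IndefiniteDescription.
From mathcomp Require all_boot all_algebra all_field.
Import ListNotations.

(** * Colour separation by evaluating polynomials over a finite field *)

Module ReedSolomon.
Import all_boot all_algebra all_field.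
Import GRing.Theory.
Set Implicit Arguments. Unset Strict Implicit.
Local Open Scope ring_scope.

Definition bit_poly (F : finFieldType) (b x : nat) : {poly F} :=
  \poly_(i < b) (odd (x %/ 2 ^ i))%:R.

Lemma bit_poly_inj (F : finFieldType) b x y :
  (x < 2 ^ b)%N -> (y < 2 ^ b)%N -> bit_poly F b x = bit_poly F b y -> x = y.
Proof.
elim: b x y => [|b IH] x y.
  by rewrite expn0 !ltnS !leqn0 => /eqP -> /eqP ->.
move=> hx hy e.
have bitE i : (i < b.+1)%N -> odd (x %/ 2 ^ i) = odd (y %/ 2 ^ i).
  move=> hi; move/polyP/(_ i): e; rewrite !coef_poly hi.
  case: (odd (x %/ _)); case: (odd (y %/ _)) => //= /eqP.
    by rewrite oner_eq0.
  by rewrite eq_sym oner_eq0.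
have e2 : (x %/ 2 = y %/ 2)%N.
  apply: IH; rewrite ?ltn_divLR // -?expnSr //.
  apply/polyP => i; rewrite !coef_poly; case: ltnP => // hi.
  by rewrite -!divnMA -expnS bitE.
have := bitE 0%N isT; rewrite expn0 !divn1 => e1.
by rewrite (divn_eq x 2) (divn_eq y 2) e2 !modn2 e1.
Qed.

Lemma size_prod_le (F : finFieldType) (n : nat) (r : seq {poly F}) :
  {in r, forall p : {poly F}, (size p <= n.+1)%N} -> (size (\prod_(p <- r) p)%R <= (size r * n).+1)%N.
Proof.
elim: r => [|p r IH] hr; first by rewrite big_nil size_poly1.
rewrite big_cons; apply: leq_trans (size_polyMleq _ _) _.
have hp := hr p (mem_head _ _).
have {}IH : (size (\prod_(p <- r) p)%R <= (size r * n).+1)%N.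
  by apply: IH => q hq; apply: hr; rewrite inE hq orbT.
rewrite -subn1 leq_subLR add1n mulSn.
by apply: leq_trans (leq_add hp IH) _; rewrite addSn addnS.
Qed.

(** The product of the differences [bit_poly F b x - bit_poly F b y], over the [y != x] in [l], is a
    nonzero polynomial of degree at most [s * b]. Having fewer roots than [F] has elements, it is
    nonzero somewhere. *)
Lemma separating_point (F : finFieldType) b s x (l : seq nat) :
  (s * b < #|F|)%N -> (x < 2 ^ b)%N -> {in l, forall y, (y < 2 ^ b)%N} -> (size l <= s)%N ->
  exists a : F, {in l, forall y, y != x -> (bit_poly F b x).[a] != (bit_poly F b y).[a]}.
Proof.
move=> hF hx hl hs.
pose r := [seq bit_poly F b x - bit_poly F b y | y <- l & y != x].
have nz : \prod_(p <- r) p != 0.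
  rewrite prodf_seq_neq0; apply/allP => p /mapP[y]; rewrite mem_filter => /andP[yx yl] ->.
  rewrite /= subr_eq0; apply: contra yx => /eqP /bit_poly_inj e.
  by rewrite eq_sym e // hl.
have sz : (size (\prod_(p <- r) p)%R <= (s * b).+1)%N.
  apply: leq_trans (size_prod_le (n := b) _) _; last first.
    by rewrite ltnS leq_mul2r size_map size_filter (leq_trans (count_size _ _) hs) orbT.
  move=> p /mapP[y _ ->]; apply: leq_trans (size_polyD _ _) _.
  by rewrite size_polyN geq_max !(leq_trans (size_poly _ _)).
case: (pickP [pred a | ~~ root (\prod_(p <- r) p) a]) => [a /= ha|h].
  move: ha; rewrite root_bigmul => /allP ha; exists a => y yl yx.
  have /ha : bit_poly F b x - bit_poly F b y \in r.
    by apply/mapP; exists y => //; rewrite mem_filter yx.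
  by rewrite /= rootE !hornerE subr_eq0.
have all_roots : all (root (\prod_(p <- r) p)) (enum F).
  by apply/allP => a _; have /negbFE := h a.
have := max_poly_roots nz all_roots (enum_uniq _).
by rewrite -cardE => /leq_trans/(_ sz); rewrite ltnS leqNgt hF.
Qed.

(** The colour of [x] is the pair of a separating point and the value there. Equal colours share the
    point, and at the point chosen for [x] no other member of [l] takes the same value, whatever
    [l'] is. *)
Lemma separating_colour_expn (b s k : nat) : (s * b < 2 ^ k)%N -> (0 < k)%N ->
  exists phi : nat -> seq nat -> nat,
    (forall x l, (phi x l < 2 ^ (2 * k))%N) /\
    (forall x y l l', (x < 2 ^ b)%N -> {in l, forall z, (z < 2 ^ b)%N} -> (size l <= s)%N ->
       y \in l -> phi x l = phi y l' -> x = y).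
Proof.
move=> hk k0.
have [F _ cF] := pPrimePowerField (isT : prime 2) k0.
pose good x (l : seq nat) := fun a : F =>
  all (fun y => (y != x) ==> ((bit_poly F b x).[a] != (bit_poly F b y).[a])) l.
(* The default [0] serves the arguments without a separating point, so that the range bound holds
   for all of them. *)
pose al x l : F := odflt 0 [pick a | good x l a].
pose phi x l : nat := enum_rank (al x l, (bit_poly F b x).[al x l]).
have cFF : #|{: F * F}| = (2 ^ (2 * k))%N by rewrite card_prod cF -expnD mul2n addnn.
exists phi; split=> [x l|x y l l' hx hl hs yl].
  rewrite -cFF; exact: ltn_ord.
move=> /val_inj/enum_rank_inj [ea].
rewrite -ea; apply: contra_eq => xy.
have [a ha] : exists a : F, {in l, forall y, y != x -> (bit_poly F b x).[a] != (bit_poly F b y).[a]}.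
  by apply: separating_point hs => //; rewrite cF.
have : good x l (al x l).
  rewrite /al; case: pickP => //= /(_ a); case/negbT/negP.
  by apply/allP => z zl; apply/implyP => ?; apply: ha.
by move/allP/(_ y yl); rewrite eq_sym xy.
Qed.

Lemma In_mem (x : nat) (l : seq nat) : List.In x l <-> x \in l.
Proof.
elim: l => [|y l IH] //=; rewrite inE; split.
  by case=> [->|/IH ->]; rewrite ?eqxx ?orbT.
by case/orP=> [/eqP ->|/IH]; [left | right].
Qed.

Lemma pow_expn m n : Nat.pow m n = expn m n.
Proof. by elim: n => // n IH; rewrite expnS /= IH multE. Qed.

Lemma separating_colour (s b : nat) :
  exists phi : nat -> list nat -> nat,
    (forall x l, Peano.lt (phi x l) (Nat.pow 2 (Nat.mul 2 (S (Nat.log2 (Nat.mul s b)))))) /\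
    (forall x y l l', Peano.lt x (Nat.pow 2 b) ->
       (forall z, List.In z l -> Peano.lt z (Nat.pow 2 b)) ->
       Peano.le (length l) s -> List.In y l -> phi x l = phi y l' -> x = y).
Proof.
set k := S (Nat.log2 _).
have hk : (s * b < 2 ^ k)%N.
  apply/ltP; rewrite -multE -pow_expn /k.
  case: (Nat.mul s b) => [|n]; first exact/ltP.
  have [_ h] := PeanoNat.Nat.log2_spec (S n) (PeanoNat.Nat.lt_0_succ _); exact: h.
have [phi [h1 h2]] := separating_colour_expn hk (ltn0Sn _).
exists phi; rewrite multE !pow_expn; split=> [x l|x y l l' hx hl hs yl].
  exact/ltP.
apply: h2 => //; first exact/ltP.
- by move=> z /In_mem/hl/ltP.
- exact/leP.
- exact/In_mem.
Qed.

End ReedSolomon.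

(** * Level profiles and iterated colour reduction *)

Open Scope nat_scope.

Definition adjacent (x y : nat) : Prop := x <= S y /\ y <= S x.

Definition truncate (i : nat) : list nat -> list nat := map (Nat.min i).

Definition count_le (i : nat) (l : list nat) : nat :=
  length (filter (fun x => x <=? i) l).

(** An entry above [i] has only adjacent values that are at least [i], and these all truncate to
    [i]. Hence only the entries at most [i] branch. *)
Fixpoint neighbours (i : nat) (l : list nat) : list (list nat) :=
  match l with
  | [] => [[]]
  | x :: r =>
      let choices := if x <=? i then [pred x; x; S x] else [i] in
      flat_map (fun g => map (cons g) (neighbours i r)) choices
  end.

Lemma neighbours_complete i l l' :
  Forall2 adjacent l l' -> In (truncate i l') (neighbours i (truncate (S i) l)).
Proof.
  induction 1 as [|x y l l' [h1 h2] _ IH]; [now left|].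
  unfold truncate in *; cbn [map neighbours].
  apply in_flat_map; exists (Nat.min i y); split; [|now apply in_map].
  destruct (Nat.leb_spec (Nat.min (S i) x) i); cbn [In]; lia.
Qed.

Lemma neighbours_length i l : length (neighbours i l) = 3 ^ count_le i l.
Proof.
  unfold count_le; induction l as [|x r IH]; [reflexivity|].
  cbn [neighbours filter]; destruct (x <=? i);
    cbn [flat_map length]; rewrite ?length_app, ?length_map, IH;
    cbn [length Nat.pow]; lia.
Qed.

Lemma count_le_truncate i j l : i < j -> count_le i (truncate j l) = count_le i l.
Proof.
  intros h; unfold count_le, truncate; induction l as [|x r IH]; [reflexivity|].
  cbn [map filter].
  destruct (Nat.leb_spec (Nat.min j x) i), (Nat.leb_spec x i); cbn [length]; lia.
Qed.

Lemma count_le_mono i j l : i <= j -> count_le i l <= count_le j l.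
Proof.
  intros h; unfold count_le; induction l as [|x r IH]; [reflexivity|].
  cbn [filter].
  destruct (Nat.leb_spec x i), (Nat.leb_spec x j); cbn [length]; lia.
Qed.

Definition positions_le (i : nat) (l : list nat) : list nat :=
  filter (fun j => nth j l 0 <=? i) (seq 0 (length l)).

Lemma positions_le_length i l : length (positions_le i l) = count_le i l.
Proof.
  unfold positions_le, count_le; induction l as [|x r IH]; [reflexivity|].
  assert (h : length (filter (fun j => nth j (x :: r) 0 <=? i) (seq 1 (length r)))
              = length (filter (fun x => x <=? i) r)).
  { rewrite <- IH, <- seq_shift; clear IH.
    induction (seq 0 (length r)) as [|j q IHq]; [reflexivity|].
    cbn [map filter nth] in *; destruct (nth j r 0 <=? i); cbn [length]; lia. }
  cbn [length seq filter nth] in *; destruct (x <=? i); cbn [length]; lia.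
Qed.

Lemma truncate_truncate i j l : i <= j -> truncate i (truncate j l) = truncate i l.
Proof. intros h; unfold truncate; rewrite map_map; apply map_ext; lia. Qed.

Lemma Forall2_nth_adjacent l l' m :
  Forall2 adjacent l l' -> adjacent (nth m l 0) (nth m l' 0).
Proof.
  intros h; revert m; induction h; intros [|m]; cbn; auto; split; lia.
Qed.

Lemma flat_map_length_const {A B : Type} (f : A -> list B) (n : nat) (l : list A) :
  (forall x, length (f x) = n) -> length (flat_map f l) = length l * n.
Proof.
  intros h; induction l as [|x l IH]; [reflexivity|].
  cbn; rewrite length_app, h; lia.
Qed.

(** With [k = S (Nat.log2 (s * b))], the field of size [2 ^ k] has more than [s * b] elements; the
    factor 2 is there because a colour is a pair of field elements. *)
Definition round_bits (s b : nat) : nat := 2 * S (Nat.log2 (s * b)).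

(* One round of Linial's colour reduction costs one further level of [l]: the colour of
   round [i] only reads [truncate (S i) l], and a neighbour of [l] has at most
   [3 ^ count_le (S i) l] such truncations, whatever the total number of levels. *)
Lemma iterated_colouring (n b a i : nat) :
  n <= 2 ^ b ->
  exists c : list nat -> nat -> nat,
    (forall l m, c (truncate (S i) l) m = c l m) /\
    (forall l m, c l m < 2 ^ Nat.iter i (round_bits (3 ^ a * a)) b) /\
    (forall l l' m m', length l = n -> Forall2 adjacent l l' -> count_le (S i) l <= a ->
       m < n -> m' < n -> nth m l 0 = 0 -> nth m' l' 0 = 0 -> c l m = c l' m' -> m = m').
Proof.
  intros hn; induction i as [|i (c & cT & cR & cP)].
  (* The reduction modulo [2 ^ b] bounds the colour for every [m] and leaves the positions below [n]
     unchanged. *)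
  { exists (fun _ m => m mod 2 ^ b); split; [reflexivity|split].
    - intros _ m; apply Nat.mod_upper_bound, Nat.pow_nonzero; lia.
    - intros l l' m m' _ _ _ h1 h2 _ _; rewrite !Nat.mod_small by lia; auto. }
  set (B := Nat.iter i _ b) in *.
  destruct (ReedSolomon.separating_colour (3 ^ a * a) B) as (phi & phiR & phiP).
  (* All colours a conflicting vertex may hold: [g] runs over the possible truncated neighbours, and
     a position of level 0 in a neighbour has level at most 1 in [l]. *)
  set (F := fun l => flat_map (fun g => map (c g) (positions_le 1 l)) (neighbours (S i) l)).
  exists (fun l m => phi (c l m) (F (truncate (S (S i)) l))); split; [|split].
  - intros l m; rewrite (truncate_truncate (S (S i))) by lia; f_equal.
    rewrite <- (cT (truncate _ l)), <- (cT l), truncate_truncate by lia; reflexivity.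
  - intros l m; apply phiR.
  - intros l l' m m' hl hA hc hm hm' h0 h0' e.
    apply (cP l l'); auto.
    { pose proof (count_le_mono (S i) (S (S i)) l); lia. }
    eapply phiP in e; auto.
    + intros z hz; apply in_flat_map in hz as (g & _ & hz).
      apply in_map_iff in hz as (j & <- & _); apply cR.
    + unfold F.
      rewrite (flat_map_length_const _ (count_le 1 l)).
      * rewrite neighbours_length, count_le_truncate by lia.
        apply Nat.mul_le_mono; [apply Nat.pow_le_mono_r; [lia|]|];
          (etransitivity; [apply (count_le_mono _ (S (S i)))|exact hc]); lia.
      * intros g; rewrite length_map, positions_le_length; apply count_le_truncate; lia.
    + apply in_flat_map; exists (truncate (S i) l'); split; [now apply neighbours_complete|].
      apply in_map_iff; exists m'; split; [apply cT|].
      apply filter_In; split.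
      * apply in_seq; unfold truncate; rewrite length_map; lia.
      * apply Nat.leb_le; unfold truncate.
        change 0 with (Nat.min (S (S i)) 0) at 1; rewrite map_nth.
        destruct (Forall2_nth_adjacent l l' m' hA); lia.
Qed.

(** * Binary and unary codewords *)

Fixpoint bits (b n : nat) : list bool :=
  match b with
  | O => []
  | S b' => Nat.odd n :: bits b' (Nat.div2 n)
  end.

Lemma bits_length b n : length (bits b n) = b.
Proof. revert n; induction b; cbn; auto. Qed.

Lemma bits_inj b n n' : n < 2 ^ b -> n' < 2 ^ b -> bits b n = bits b n' -> n = n'.
Proof.
  revert n n'; induction b as [|b IH]; cbn [bits Nat.pow]; intros n n' h h' e; [lia|].
  injection e as e1 e2.
  rewrite (Nat.div2_odd n), (Nat.div2_odd n'), e1.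
  pose proof (Nat.div2_odd n); pose proof (Nat.div2_odd n').
  apply IH in e2; lia.
Qed.

Lemma unary_prefix_inj (t t' : nat) (s s' : list bool) :
  repeat true t ++ false :: s = repeat true t' ++ false :: s' -> t = t' /\ s = s'.
Proof.
  revert t'; induction t as [|t IH]; intros [|t'] e; cbn in e; try discriminate.
  - now injection e.
  - injection e as e; apply IH in e as [-> ->]; auto.
Qed.

(** * Base-2 logarithms and the number of bits left by the rounds *)

Open Scope R_scope.

Lemma ln2_pos : 0 < ln 2.
Proof. rewrite <- ln_1; apply ln_increasing; lra. Qed.

Lemma log2_Rpower x : log2 (Rpower 2 x) = x.
Proof. unfold log2; rewrite ln_Rpower; field; pose proof ln2_pos; lra. Qed.

Lemma Rpower_log2 x : 0 < x -> Rpower 2 (log2 x) = x.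
Proof.
  intros h; unfold Rpower, log2.
  replace (ln x / ln 2 * ln 2) with (ln x) by (field; pose proof ln2_pos; lra).
  now apply exp_ln.
Qed.

Lemma log2_le x y : 0 < x -> x <= y -> log2 x <= log2 y.
Proof.
  intros h [h1| ->]; [|lra]; unfold log2, Rdiv.
  apply Rmult_le_compat_r; [left; apply Rinv_0_lt_compat, ln2_pos|].
  left; now apply ln_increasing.
Qed.

Lemma Rpower2_le x y : x <= y -> Rpower 2 x <= Rpower 2 y.
Proof. intros; apply Rle_Rpower; lra. Qed.

Lemma Rpower_pos x y : 0 < Rpower x y.
Proof. apply exp_pos. Qed.

Lemma Rpower2_ge_1 x : 0 <= x -> 1 <= Rpower 2 x.
Proof. intros; rewrite <- (Rpower_O 2) by lra; now apply Rpower2_le. Qed.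

Lemma Rpower2_INR n : Rpower 2 (INR n) = INR (2 ^ n).
Proof. rewrite Rpower_pow, pow_INR by lra; reflexivity. Qed.

Lemma INR_lt_pow2 n : INR n < Rpower 2 (INR n).
Proof. rewrite Rpower2_INR; apply lt_INR, Nat.pow_gt_lin_r; lia. Qed.

Lemma separation_list_size a : (1 <= a)%nat -> INR (3 ^ a * a) <= Rpower 2 (3 * INR a).
Proof.
  intros ha; replace (3 * INR a) with (INR (3 * a)) by (rewrite mult_INR; simpl; lra).
  rewrite Rpower2_INR; apply le_INR.
  replace (3 * a)%nat with (2 * a + a)%nat by lia.
  rewrite Nat.pow_add_r, Nat.pow_mul_r.
  pose proof (Nat.pow_gt_lin_r 2 a ltac:(lia)).
  apply Nat.mul_le_mono; [apply Nat.pow_le_mono_l; simpl; lia|lia].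
Qed.

(** Here [y] measures the excess of [b] over the order of [a], and a round replaces it by its
    logarithm: the product of the list size and [b] is at most [2 ^ (3 a) * 2 ^ 5 * 2 ^ a * y]. *)
Lemma round_bits_le a b y :
  (1 <= a)%nat -> 1 <= y -> INR b <= 32 * INR a * y ->
  INR (round_bits (3 ^ a * a) b) <= 20 * INR a + 2 * log2 y.
Proof.
  intros ha hy hb.
  assert (ha' : 1 <= INR a) by (apply (le_INR 1); lia).
  assert (hl : 0 <= log2 y)
    by (pose proof (log2_le 1 y); unfold log2 at 1 in H; rewrite ln_1 in H; lra).
  unfold round_bits; rewrite mult_INR, (S_INR (Nat.log2 _)); change (INR 2) with 2.
  pose proof (separation_list_size a ha) as hs.
  set (s := (3 ^ a * a)%nat) in *.
  destruct (Nat.eq_dec (s * b) 0) as [->|nz]; [simpl; lra|].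
  enough (INR (Nat.log2 (s * b)) <= 4 * INR a + 5 + log2 y) by lra.
  rewrite <- (log2_Rpower (INR _)), <- (log2_Rpower (4 * INR a + 5 + log2 y)).
  apply log2_le; [apply Rpower_pos|].
  rewrite Rpower2_INR.
  apply Rle_trans with (INR (s * b)).
  { apply le_INR, Nat.log2_spec; lia. }
  rewrite mult_INR.
  replace (4 * INR a + 5 + log2 y) with (3 * INR a + (INR 5 + (INR a + log2 y)))
    by (simpl; lra).
  rewrite !Rpower_plus, Rpower_log2, (Rpower2_INR 5) by lra.
  apply Rmult_le_compat; auto using pos_INR.
  replace (INR (2 ^ 5)) with 32 by (simpl; lra).
  apply (Rle_trans _ _ _ hb); rewrite Rmult_assoc.
  pose proof (INR_lt_pow2 a).
  apply Rmult_le_compat_l; [lra|]; apply Rmult_le_compat_r; lra.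
Qed.

(** The invariant [b <= 32 a * max(1, x)] survives a round when [x] becomes [log2 x], since
    [20 a + 2 log2 x] is below the new bound. The rounds stop exactly when [x <= 1]. *)
Lemma iterated_round_bits_le a f x b :
  (1 <= a)%nat -> x <= Rpower 2 (INR f) -> INR b <= 32 * INR a * Rmax 1 x ->
  INR (Nat.iter (logstar_aux (S f) x) (round_bits (3 ^ a * a)) b) <= 32 * INR a.
Proof.
  intros ha; revert x b.
  assert (ha' : 1 <= INR a) by (apply (le_INR 1); lia).
  induction f as [|f IH]; intros x b hx hb.
  { rewrite Rpower_O in hx by lra; simpl.
    destruct (Rle_dec x 1); [|lra]; simpl.
    rewrite Rmax_left in hb; lra. }
  remember (S f) as f' eqn:ef; simpl logstar_aux.
  destruct (Rle_dec x 1) as [h1|h1]; [simpl; rewrite Rmax_left in hb; lra|].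
  rewrite Nat.iter_succ_r; subst f'; apply IH.
  (* The fuel remains sufficient: [log2 x <= f + 1 <= 2 ^ f]. *)
  - apply Rle_trans with (INR (S f)).
    + rewrite <- (log2_Rpower (INR (S f))); apply log2_le; lra.
    + rewrite Rpower2_INR; apply le_INR, Nat.pow_gt_lin_r; lia.
  - rewrite Rmax_right in hb by lra.
    apply (Rle_trans _ _ _ (round_bits_le a b x ha ltac:(lra) hb)).
    unfold Rmax; destruct (Rle_dec 1 (log2 x)); nra.
Qed.

(** * Counting heavy messages and bounding the mass of light ones *)

Definition heavy {T : Type} (theta : R) (P : T -> R) (m : T) : bool :=
  if Rle_dec theta (P m) then true else false.

Lemma heavy_true {T : Type} theta (P : T -> R) m : heavy theta P m = true <-> theta <= P m.
Proof. unfold heavy; destruct (Rle_dec theta (P m)); intuition discriminate. Qed.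

Lemma heavy_count {T : Type} theta (P : T -> R) (l : list T) :
  (forall m, 0 <= P m) -> INR (length (filter (heavy theta P) l)) * theta <= sumU l P.
Proof.
  intros h; induction l as [|m l IH]; [simpl; lra|].
  cbn [filter sumU fold_right]; fold (sumU l P).
  unfold heavy at 1; destruct (Rle_dec theta (P m)) as [hm|hm].
  - cbn [length]; rewrite S_INR; lra.
  - specialize (h m); lra.
Qed.

Lemma dist_heavy_count {T : Type} (enum : list T) P x :
  is_dist enum P -> INR (length (filter (heavy (Rpower 2 (- x)) P) enum)) <= Rpower 2 x.
Proof.
  intros [h0 h1]; pose proof (heavy_count (Rpower 2 (- x)) P enum h0) as h.
  rewrite h1 in h; pose proof (Rpower_pos 2 x) as hp.
  apply Rmult_le_reg_r with (Rpower 2 (- x)); [apply Rpower_pos|].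
  rewrite <- Rpower_plus, Rplus_opp_r, Rpower_O; lra.
Qed.

Lemma sumU_ge {T : Type} (l : list T) (f : T -> R) m :
  (forall m, 0 <= f m) -> In m l -> f m <= sumU l f.
Proof.
  intros h; induction l as [|a l IH]; [intros []|].
  assert (h0 : 0 <= sumU l f).
  { clear IH; induction l as [|b l IH]; simpl; [lra|]; specialize (h b); lra. }
  intros [->|hm]; cbn; fold (sumU l f); [lra|]; specialize (h a); specialize (IH hm); lra.
Qed.

Lemma sumU_le {T : Type} (l : list T) (f g : T -> R) :
  (forall m, f m <= g m) -> sumU l f <= sumU l g.
Proof.
  intros h; induction l as [|a l IH]; simpl; [lra|]; specialize (h a); lra.
Qed.

Lemma sumU_scal {T : Type} (l : list T) (f : T -> R) c :
  sumU l (fun m => f m * c) = sumU l f * c.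
Proof. induction l as [|a l IH]; simpl; [lra|]; rewrite IH; lra. Qed.

Lemma surprisal_ge_0 {T : Type} (enum : list T) P m :
  finite_enum enum -> is_dist enum P -> 0 <= P m * log2 (/ P m).
Proof.
  intros [_ hin] [h0 h1].
  pose proof (sumU_ge enum P m h0 (hin m)) as hle; rewrite h1 in hle.
  destruct (h0 m) as [hp|e]; [|rewrite <- e; lra].
  apply Rmult_le_pos; [lra|].
  replace 0 with (log2 1) by (unfold log2; rewrite ln_1; lra).
  apply log2_le; [lra|]; rewrite <- Rinv_1; now apply Rinv_le_contravar.
Qed.

Lemma entropy_ge_0 {T : Type} (enum : list T) P :
  finite_enum enum -> is_dist enum P -> 0 <= entropy enum P.
Proof.
  intros he hP; unfold entropy.
  replace 0 with (sumU enum P * 0) by lra; rewrite <- sumU_scal.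
  apply sumU_le; intros m; rewrite Rmult_0_r; now apply (surprisal_ge_0 enum).
Qed.

(** Markov's inequality for the surprisal [log2 (/ P m)], which is nonnegative with mean the entropy
    and is at least [x] on light messages. *)
Lemma light_mass_le {T : Type} (enum : list T) P eps x :
  finite_enum enum -> is_dist enum P -> 0 < eps -> 0 < x -> entropy enum P / eps <= x ->
  sumU enum (fun m => if Rle_dec (Rpower 2 (- x)) (P m) then 0 else P m) <= eps.
Proof.
  intros he hP heps hx hH.
  apply Rmult_le_reg_r with x; [assumption|].
  rewrite <- sumU_scal.
  apply Rle_trans with (entropy enum P).
  - apply sumU_le; intros m; pose proof (surprisal_ge_0 enum P m he hP) as hs.
    destruct (Rle_dec _ _) as [h|h]; [lra|].
    destruct hP as [h0 _]; destruct (h0 m) as [hp|e]; [|rewrite <- e; lra].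
    apply Rmult_le_compat_l; [lra|].
    rewrite <- (log2_Rpower x); apply log2_le; [apply Rpower_pos|].
    rewrite <- (Rinv_inv (Rpower 2 x)), <- Rpower_Ropp.
    apply Rinv_le_contravar; lra.
  - apply Rmult_le_compat_r with (r := eps) in hH; [|lra].
    unfold Rdiv in hH; rewrite Rmult_assoc, Rinv_l in hH; lra.
Qed.

(** * Levels of probabilities under closeness *)

Fixpoint level (n : nat) (th : nat -> R) (p : R) : nat :=
  match n with
  | O => O
  | S n' => if Rle_dec (th O) p then O else S (level n' (fun j => th (S j)) p)
  end.

Lemma level_bound n th p : (level n th p <= n)%nat.
Proof.
  revert th; induction n as [|n IH]; intros th; simpl; [lia|].
  destruct (Rle_dec _ _); [lia|]; specialize (IH (fun j => th (S j))); lia.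
Qed.

Lemma level_le n th p j :
  (forall i, th (S i) <= th i) -> (j < n)%nat -> (level n th p <= j)%nat <-> th j <= p.
Proof.
  revert th j; induction n as [|n IH]; intros th j hth hj; [lia|]; simpl.
  destruct (Rle_dec (th O) p) as [h|h].
  - split; [intros _|lia]; clear hj; induction j as [|j IHj]; [lra|].
    specialize (hth j); lra.
  - destruct j as [|j]; [split; [lia|intros; lra]|].
    rewrite <- (IH (fun j => th (S j)) j) by (auto; lia); lia.
Qed.

(** If [p] passes the threshold at its level, [p'] passes the next one. Near the cap [n] there is
    nothing to test, because no level exceeds [n]. *)
Lemma level_adjacent n th p p' :
  (forall i, th (S i) <= th i) ->
  (forall j, th j <= p -> th (S j) <= p') -> (forall j, th j <= p' -> th (S j) <= p) ->
  adjacent (level n th p) (level n th p').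
Proof.
  intros hth.
  assert (half : forall p p', (forall j, th j <= p -> th (S j) <= p') ->
            (level n th p' <= S (level n th p))%nat).
  { intros q q' h; pose proof (level_bound n th q').
    destruct (Nat.lt_ge_cases (S (level n th q)) n) as [hn|hn]; [|lia].
    apply level_le; auto; apply h, (level_le n); auto; lia. }
  intros h h'; split; auto.
Qed.

(** [P] and [P'] are two possible senders for the same receiver [Q]; this is why thresholds descend
    in steps of [2 * Delta]. *)
Lemma close_trans {T : Type} Delta (P Q P' : T -> R) :
  close Delta P Q -> close Delta P' Q -> close (2 * Delta) P P'.
Proof.
  intros h h' m; destruct (h m) as [h1 h2], (h' m) as [h3 h4].
  replace (2 * Delta) with (Delta + Delta) by lra; rewrite Rpower_plus.
  pose proof (Rpower_pos 2 Delta) as hp.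
  split; rewrite Rmult_assoc; eapply Rle_trans; eauto;
    apply Rmult_le_compat_l; lra.
Qed.

Lemma close_lower {T : Type} Delta (P Q : T -> R) x m :
  close Delta P Q -> Rpower 2 (- x) <= P m -> Rpower 2 (- (x + Delta)) <= Q m.
Proof.
  intros h hP; destruct (h m) as [h1 _].
  apply Rmult_le_reg_l with (Rpower 2 Delta); [apply Rpower_pos|].
  rewrite <- Rpower_plus; replace (Delta + - (x + Delta)) with (- x) by lra; lra.
Qed.

Lemma close_sym {T : Type} Delta (P Q : T -> R) : close Delta P Q -> close Delta Q P.
Proof. intros h m; destruct (h m); auto. Qed.

(** * The code for a fixed threshold *)

Definition nat_ceil (x : R) : nat := Z.to_nat (up x).

(** The strict lower bound makes the threshold exponent positive even at zero entropy, as
    [light_mass_le] requires. *)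
Lemma nat_ceil_bounds x : 0 <= x -> x < INR (nat_ceil x) <= x + 1.
Proof.
  intros hx; destruct (archimed x) as [h1 h2].
  assert (hz : (0 < up x)%Z) by (apply lt_IZR; lra).
  unfold nat_ceil; rewrite INR_IZR_INZ, Z2Nat.id by lia; lra.
Qed.

Lemma position_exists {T : Type} (enum : list T) :
  finite_enum enum ->
  exists pos : T -> nat, forall m, (pos m < length enum)%nat /\ nth_error enum (pos m) = Some m.
Proof.
  intros [_ hin].
  apply (functional_choice (fun m i => (i < length enum)%nat /\ nth_error enum i = Some m)).
  intros m; destruct (In_nth_error enum m (hin m)) as [i hi]; exists i; split; auto.
  apply nth_error_Some; congruence.
Qed.

Lemma threshold_code {T : Type} (enum : list T) Delta (t : nat) :
  finite_enum enum -> 0 <= Delta ->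
  exists chi : (T -> R) -> T -> list bool,
    (forall P m, INR (length (chi P m)) <=
       64 * Rpower 2 (INR t + 2 * (INR (logstar (length enum)) + 1) * Delta)) /\
    (forall P P' m m', is_dist enum P -> close (2 * Delta) P P' ->
       Rpower 2 (- INR t) <= P m -> Rpower 2 (- INR t) <= P' m' ->
       chi P m = chi P' m' -> m = m').
Proof.
  intros he hD; set (N := length enum); set (k := logstar N).
  destruct (position_exists enum he) as [pos hpos].
  (* [A] bounds the number of messages of level at most [k + 1], the levels that [k] rounds depend
     on; then [a <= A + 1 <= 2 A] turns [32 a] bits into [64 A]. *)
  set (A := Rpower 2 (INR t + 2 * (INR k + 1) * Delta)).
  assert (hA : 1 <= A).
  { apply Rpower2_ge_1; pose proof (pos_INR t); pose proof (pos_INR k); nra. }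
  destruct (nat_ceil_bounds A ltac:(lra)) as [ha1 ha2]; set (a := nat_ceil A) in *.
  assert (ha : (1 <= a)%nat) by (apply INR_le; simpl; lra).
  (* Starting from [N] bits rather than about [log2 N] is affordable: the bound on the rounds allows
     [32 a * max(1, N)]. *)
  destruct (iterated_colouring N N a k) as (c & _ & cR & cP).
  { apply Nat.lt_le_incl, Nat.pow_gt_lin_r; lia. }
  set (b := Nat.iter k _ N) in *.
  set (th := fun j => Rpower 2 (- (INR t + 2 * INR j * Delta))).
  assert (hth : forall j, th (S j) <= th j).
  { intros j; apply Rpower2_le; rewrite S_INR; lra. }
  assert (hth0 : th O = Rpower 2 (- INR t)) by (unfold th; f_equal; simpl; lra).
  (* The cap [S (S k)] keeps level [S k] strictly below it, so that [level_le] describes it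
     exactly. *)
  set (lev := fun P : T -> R => map (fun m => level (S (S k)) th (P m)) enum).
  assert (lev0 : forall P m, Rpower 2 (- INR t) <= P m -> nth (pos m) (lev P) O = O).
  { intros P m h; unfold lev; apply nth_error_nth.
    rewrite nth_error_map; destruct (hpos m) as [_ ->]; cbn [option_map]; f_equal.
    enough (level (S (S k)) th (P m) <= 0)%nat by lia.
    apply level_le; auto; [lia|]; now rewrite hth0. }
  exists (fun P m => bits b (c (lev P) (pos m))); split.
  - intros P m; rewrite bits_length.
    apply Rle_trans with (32 * INR a); [|lra].
    unfold b, k, logstar; apply iterated_round_bits_le; auto.
    + left; apply INR_lt_pow2.
    + assert (1 <= INR a) by (apply (le_INR 1); lia).
      pose proof (Rmax_l 1 (INR N)); pose proof (Rmax_r 1 (INR N)).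
      apply Rle_trans with (1 * Rmax 1 (INR N)); [lra|].
      apply Rmult_le_compat_r; lra.
  - intros P P' m m' hP hc hm hm' e.
    apply bits_inj in e; auto.
    apply (cP (lev P) (lev P')) in e; auto; try apply hpos.
    + destruct (hpos m) as [_ h1], (hpos m') as [_ h2]; congruence.
    + apply length_map.
    + unfold lev; clear - hc hth; clearbody k; clear N; induction enum as [|u l IH]; constructor; auto.
      assert (step : forall P P' : T -> R, close (2 * Delta) P P' ->
                forall j, th j <= P u -> th (S j) <= P' u).
      { intros R R' hR j h; unfold th in *.
        apply close_lower with (Q := R') (Delta := 2 * Delta) in h; auto.
        eapply Rle_trans; [|exact h]; apply Rpower2_le; rewrite S_INR; lra. }
      apply level_adjacent; auto; apply step; auto using close_sym.
    + apply INR_le, Rle_trans with A; [|lra].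
      unfold A; eapply Rle_trans; [right|apply (dist_heavy_count enum P _ hP)].
      f_equal; unfold count_le, lev; clear - hth; clearbody k; clear N; induction enum as [|u l IH]; [reflexivity|].
      cbn [map filter].
      assert (E : (level (S (S k)) th (P u) <=? S k)%nat
          = heavy (Rpower 2 (- (INR t + 2 * (INR k + 1) * Delta))) P u).
      { apply Bool.eq_iff_eq_true; rewrite Nat.leb_le, heavy_true, level_le by (auto; lia).
        unfold th; rewrite S_INR; reflexivity. }
      rewrite E; destruct (heavy _ P u); cbn [length]; congruence.
Qed.

(** * Decoding and assembly of the scheme *)

(** At most one message is consistent with a given [Q] and string, so choice over such pairs yields
    the decoder, with [None] where no message is consistent. *)
Lemma decoder_exists {T : Type} (enum : list T) Delta
  (E : (T -> R) -> T -> option (list bool)) :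
  (forall P P' Q m m' s, is_dist enum P -> is_dist enum P' -> is_dist enum Q ->
     close Delta P Q -> close Delta P' Q -> E P m = Some s -> E P' m' = Some s -> m = m') ->
  exists D : (T -> R) -> option (list bool) -> option T,
    (forall P Q, is_dist enum P -> is_dist enum Q -> close Delta P Q ->
       forall m s, E P m = Some s -> D Q (Some s) = Some m) /\
    (forall Q, is_dist enum Q -> D Q None = None).
Proof.
  intros hE.
  set (candidate := fun Q s m =>
    exists P, is_dist enum P /\ is_dist enum Q /\ close Delta P Q /\ E P m = Some s).
  destruct (functional_choice (fun (Qs : (T -> R) * list bool) (o : option T) =>
    forall m, candidate (fst Qs) (snd Qs) m -> o = Some m)) as [d hd].
  { intros [Q s]; destruct (classic (exists m, candidate Q s m)) as [[m (P & hm)]|no].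
    - exists (Some m); intros m' (P' & hm'); f_equal.
      destruct hm as (? & ? & ? & ?), hm' as (? & ? & ? & ?).
      now apply (hE P P' Q m m' s).
    - exists None; intros m hm; elim no; now exists m. }
  exists (fun Q o => match o with Some s => d (Q, s) | None => None end); split; auto.
  intros P Q hP hQ hc m s e; apply hd; exists P; auto.
Qed.

Lemma expected_length_le {T : Type} (enum : list T) P (len : T -> R) B :
  is_dist enum P -> (forall m, len m <= B) -> sumU enum (fun m => P m * len m) <= B.
Proof.
  intros [h0 h1] h.
  apply Rle_trans with (sumU enum (fun m => P m * B)).
  - apply sumU_le; intros m; apply Rmult_le_compat_l; auto.
  - rewrite sumU_scal, h1; lra.
Qed.

(** Used to absorb additive terms: [Delta <= Delta * k] and [2 (k + 1) Delta <= 4 k Delta] for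
    [k = logstar N]. *)
Lemma logstar_pos N : (1 < N)%nat -> 1 <= INR (logstar N).
Proof.
  intros h; unfold logstar; cbn [logstar_aux].
  apply lt_INR in h; change (INR 1) with 1 in h.
  destruct (Rle_dec (INR N) 1); [lra|].
  rewrite S_INR; pose proof (pos_INR (logstar_aux N (log2 (INR N)))); lra.
Qed.

(** Fewer than two messages can be this heavy, as their number is at most [2 ^ x < 2]. *)
Lemma majority_unique {T : Type} (enum : list T) Q x m m' :
  finite_enum enum -> is_dist enum Q -> x < 1 ->
  Rpower 2 (- x) <= Q m -> Rpower 2 (- x) <= Q m' -> m = m'.
Proof.
  intros [_ hin] hQ hx hm hm'.
  pose proof (dist_heavy_count enum Q x hQ) as hc.
  assert (h2 : Rpower 2 x < 2).
  { rewrite <- (Rpower_1 2) at 2 by lra; apply Rpower_lt; lra. }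
  apply heavy_true in hm, hm'.
  assert (im : forall u, heavy (Rpower 2 (- x)) Q u = true ->
            In u (filter (heavy (Rpower 2 (- x)) Q) enum)) by (intros; now apply filter_In).
  apply im in hm, hm'.
  destruct (filter _ enum) as [|u [|v l]]; [destruct hm| |].
  - destruct hm as [<-|[]], hm' as [<-|[]]; reflexivity.
  - cbn [length] in hc; rewrite !S_INR in hc; pose proof (pos_INR (length l)); lra.
Qed.

(** The left side is at most [66 B <= 2 ^ 7 * B], with exponent at most [8 + h + 4 y]; since
    [h + y >= 1 / 4], the 8 is at most [32 (h + y)]. This gives the constant 36. *)
Lemma code_length_le t h y :
  0 <= h -> 0 <= y -> 1 / 4 <= h + y -> INR t <= h + 1 ->
  INR t + 1 + 64 * Rpower 2 (INR t + 4 * y) <= Rpower 2 (36 * (h + y)).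
Proof.
  intros hh hy hx ht.
  set (B := Rpower 2 (INR t + 4 * y)).
  assert (h1 : INR t + 1 <= 2 * B).
  { assert (Rpower 2 (INR t) <= B) by (apply Rpower2_le; lra).
    pose proof (INR_lt_pow2 t); pose proof (Rpower2_ge_1 (INR t) (pos_INR t)); lra. }
  apply Rle_trans with (Rpower 2 (INR 7) * B).
  { rewrite Rpower2_INR; pose proof (Rpower_pos 2 (INR t + 4 * y)); fold B in H.
    replace (INR (2 ^ 7)) with 128 by (simpl; lra); lra. }
  unfold B; rewrite <- Rpower_plus; apply Rpower2_le; simpl; lra.
Qed.

Theorem theorem2 :
  exists C : R, 1 < C /\
    forall (T : Type) (enum : list T), finite_enum enum ->
    forall eps Delta : R, 0 < eps -> 0 <= Delta ->
    exists (E : (T -> R) -> T -> option (list bool))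
           (D : (T -> R) -> option (list bool) -> option T),
      is_UCS enum Delta eps
        (fun P => Rpower C (entropy enum P / eps
                            + Delta * INR (logstar (length enum)))) E D.
Proof.
  exists (Rpower 2 36); split.
  { rewrite <- (Rpower_O 2) by lra; apply Rpower_lt; lra. }
  intros T enum he eps Delta heps hD.
  (* Here [logstar] vanishes and cannot absorb [Delta], but the empty string encodes the only
     possible message. *)
  destruct (le_lt_dec (length enum) 1) as [small|big].
  { exists (fun _ _ => Some []).
    destruct (decoder_exists enum Delta (fun _ _ => Some [])) as (D & D1 & D2).
    { intros _ _ _ m m' _ _ _ _ _ _ _ _; destruct he as [_ hin].
      pose proof (hin m) as hm; pose proof (hin m') as hm'.
      destruct enum as [|u [|v l]]; [destruct hm| |simpl in small; lia].
      destruct hm as [<-|[]], hm' as [<-|[]]; reflexivity. }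
    exists D; split; [exact D1|split; [exact D2|split]]; intros P hP.
    - apply Rle_trans with (sumU enum P * 0); [|lra].
      rewrite <- sumU_scal; apply sumU_le; intros m; lra.
    - apply expected_length_le; auto; intros _; simpl; left; apply Rpower_pos. }
  set (k := INR (logstar (length enum))).
  pose proof (logstar_pos _ big) as hk; fold k in hk.
  destruct (functional_choice (fun t chi => _) (fun t => threshold_code enum Delta t he hD))
    as [chi hchi].
  set (h := fun P => entropy enum P / eps).
  set (t := fun P => nat_ceil (h P)).
  set (tiny := fun P => Rlt_dec (h P + Delta * k) (1 / 4)).
  set (x := fun P => if tiny P then 1 / 4 else INR (t P)).
  set (code := fun P m => if tiny P then []
                 else repeat true (t P) ++ false :: chi (t P) P m).
  set (E := fun P m => if Rle_dec (Rpower 2 (- x P)) (P m) then Some (code P m) else None).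
  assert (hh : forall P, is_dist enum P -> 0 <= h P).
  { intros P hP; apply Rmult_le_pos; [now apply entropy_ge_0|].
    left; now apply Rinv_0_lt_compat. }
  assert (inv : forall P m s, E P m = Some s -> Rpower 2 (- x P) <= P m /\ code P m = s).
  { intros P m s; unfold E; destruct (Rle_dec _ _); [|discriminate].
    intros e; injection e; auto. }
  exists E; destruct (decoder_exists enum Delta E) as (D & D1 & D2).
  { intros P P' Q m m' s hP hP' hQ hc hc' e e'.
    apply inv in e as [hm e], e' as [hm' e'].
    rewrite <- e' in e; unfold x, code in *; pose proof (hh P hP).
    destruct (tiny P) as [ht|ht], (tiny P') as [ht'|ht'].
    (* Both messages keep probability at least [2 ^ - (1 / 4 + Delta)] under [Q], and
       [Delta <= Delta * k < 1 / 4]. *)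
    - apply (majority_unique enum Q (1 / 4 + Delta)); auto.
      + nra.
      + now apply (close_lower Delta P Q).
      + now apply (close_lower Delta P' Q).
    (* The two regimes cannot collide: one sends the empty string, the other always sends the
       separator [false]. *)
    - exfalso; exact (app_cons_not_nil _ _ _ e).
    - exfalso; exact (app_cons_not_nil _ _ _ (eq_sym e)).
    - apply unary_prefix_inj in e as [et es]; rewrite et in *.
      destruct (hchi (t P')) as [_ inj].
      apply (inj P P'); auto; now apply close_trans with Q. }
  exists D; split; [exact D1|split; [exact D2|split]]; intros P hP; pose proof (hh P hP) as hP0.
  - destruct (nat_ceil_bounds (h P) hP0) as [b1 b2].
    apply Rle_trans with
      (sumU enum (fun m => if Rle_dec (Rpower 2 (- x P)) (P m) then 0 else P m)).
    { apply sumU_le; intros m; unfold E; destruct (Rle_dec _ _); lra. }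
    apply light_mass_le; auto; fold (h P); unfold x, t; destruct (tiny P); try lra; nra.
  (* This pays for [bot_len] when the encoder fails. *)
  - assert (hge : 1 <= Rpower (Rpower 2 36) (h P + Delta * k)).
    { rewrite Rpower_mult; apply Rpower2_ge_1; nra. }
    apply expected_length_le; auto; intros m; unfold E.
    destruct (Rle_dec _ _); [|exact hge].
    unfold code; destruct (tiny P) as [ht|ht]; [simpl length; simpl; fold (h P); lra|].
    cbn [enc_len]; rewrite length_app, repeat_length; cbn [length].
    rewrite plus_INR, S_INR, Rpower_mult.
    destruct (nat_ceil_bounds (h P) hP0) as [b1 b2].
    eapply Rle_trans; [|apply (code_length_le (t P) (h P) (Delta * k)); unfold t; nra].
    destruct (hchi (t P)) as [len _].
    enough (INR (length (chi (t P) P m)) <= 64 * Rpower 2 (INR (t P) + 4 * (Delta * k))) by lra.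
    eapply Rle_trans; [apply len|].
    apply Rmult_le_compat_l; [lra|]; apply Rpower2_le; fold k; nra.
Qed.
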